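(* Let $(\xi_n)_{n\ge 0}$ be a subnormal sequence of random variables on a probability space $(\Omega,\mathscr{A},\mathbb{P})$. Then for $\mathbb{P}$-almost every $\omega\in\Omega$ the sequence $(\xi_n(\omega))_{n\ge 0}$ is fully oscillating.
   Context: A real random variable $\xi$ is subnormal if $\mathbb{E}\,e^{\lambda\xi}\le e^{\lambda^2/2}$ for all $\lambda\in\mathbb{R}$. A subnormal sequence is a sequence of independent subnormal random variables. For an integer $d\ge 1$, a sequence of complex numbers $(c_n)_{n\ge 0}$ is oscillating of order $d$ if for every real polynomial $P\in\mathbb{R}[z]$ of degree at most $d$ one has $\lim_{N\to\infty}\frac1N\sum_{n=0}^{N-1}c_n e^{2\pi i P(n)}=0$. It is fully oscillating if it is oscillating of order $d$ for all $d\ge 1$. *)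

(* Defs.v *)
From HB Require Import structures.
From mathcomp Require Import all_boot all_order all_algebra finmap.
From mathcomp Require Import all_classical all_reals all_analysis.
From mathcomp Require Export complex.

Set Implicit Arguments.
Unset Strict Implicit.
Unset Printing Implicit Defensive.

Import Order.TTheory GRing.Theory Num.Theory.
Import numFieldNormedType.Exports.

Local Open Scope classical_set_scope.
Local Open Scope ring_scope.
Local Open Scope complex_scope.

Section random_variables.
Context {d : measure_display} {T : measurableType d} {R : realType}.
Variable P : probability T R.

Definition subnormal (X : {RV P >-> R}) : Prop :=
  forall l : R, ('M_P X l <= (expR (l ^+ 2 / 2))%:E)%E.

Definition mutually_independent (I : choiceType) (X : I -> {RV P >-> R}) :
    Prop :=
  forall (J : {fset I}) (A : I -> set R),
    (forall j, j \in J -> measurable (A j)) ->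
    P (\bigcap_(j in [set` J]) (X j @^-1` A j)) =
    (\prod_(j <- J) P (X j @^-1` A j))%E.

Definition subnormal_sequence (xi : nat -> {RV P >-> R}) : Prop :=
  mutually_independent xi /\ forall n, subnormal (xi n).

End random_variables.

Section oscillation.
Context {R : realType}.

Definition cexpi (t : R) : R[i] := cos t +i* sin t.

(* The average for [N = 0] is [0^-1 * 0 = 0]; it does not affect the limit.
   Convergence is in [R[i]] for its modulus, the type [R[i]^o] being [R[i]]
   with the topology induced by its norm. *)
Definition oscillating (d : nat) (c : nat -> R[i]) : Prop :=
  forall p : {poly R}, (size p <= d.+1)%N ->
    (fun N : nat => N%:R^-1 *
       \sum_(0 <= n < N) c n * cexpi (2 * pi * p.[n%:R]) : R[i]^o)
      @ \oo --> (0 : R[i]^o).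

Definition fully_oscillating (c : nat -> R[i]) : Prop :=
  forall d : nat, (1 <= d)%N -> oscillating d c.

End oscillation.

(* Main.v *)
Require Import Defs.
From HB Require Import structures.
From mathcomp Require Import all_boot all_order all_algebra finmap.
From mathcomp Require Import all_classical all_reals all_analysis.
From mathcomp Require Import measurable_realfun.
From mathcomp Require Import complex ring lra zify.

Set Implicit Arguments.
Unset Strict Implicit.
Unset Printing Implicit Defensive.

Import Order.TTheory GRing.Theory Num.Theory.
Import numFieldNormedType.Exports.
Import HBNNSimple.

Local Open Scope classical_set_scope.
Local Open Scope ring_scope.

(** For fixed real weights [c n] of modulus at most 1, the exponential moments of
    independent subnormal variables multiply, so the sum over [n < N] of
    [c n * xi n] is subnormal up to the variance factor [N], and Chernoff's
    bound makes the probability that it exceeds [t * N] in modulus at most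
    [2 * exp (- t^2 N / 2)] ([weighted_sum_tail_norm]). Exponential decay in [N]
    beats any polynomial, so by the union bound and Borel-Cantelli one may
    let the weights range, at stage [N], over a family whose cardinality is
    polynomial in [N]: almost surely, all these sums are eventually at most
    [t * N], simultaneously for every [t > 0] ([ae_weighted_averages_small]).

    The polynomials of degree below [D] are uncountably many, but for the
    first [N] terms they may be replaced by those of a finite grid, whose
    coefficients lie in [-N, N] and are spaced by [(N + 1)^-(D + 2)]: the grid has
    polynomially many points, and every fixed polynomial is eventually so
    close to some grid point that, since sine and cosine are
    1-Lipschitz, replacing one by the other changes the sum by [O(1)]
    ([small_on_grid_small]). This comparison uses that [xi n] grows at most
    linearly almost surely, which is the same uniform statement applied to the
    weights concentrated on the last index ([subnormal_linear_growth]).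

    The exceptional null set depends on the degree only; a countable union over
    the degrees concludes. *)

(** * Independence and products of expectations *)

Section independence.
Context d (T : measurableType d) (R : realType) (P : probability T R).

(** A weight [G] that is uncorrelated with every event of [X] is uncorrelated with
    every nonnegative function of [X]: both sides are linear and continuous
    along increasing limits in [f], so the case of indicators propagates through
    simple functions. *)
Lemma ge0_integral_mul_comp (X : {RV P >-> R}) (G : T -> R) (c : R) (f : R -> R) :
  measurable_fun setT G -> (forall w, 0 <= G w) -> 0 <= c ->
  (forall A, measurable A ->
     (\int[P]_w (\1_A (X w) * G w)%:E = c%:E * \int[P]_w (\1_A (X w))%:E)%E) ->
  measurable_fun [set: R] f -> (forall x, 0 <= f x) ->
  (\int[P]_w (f (X w) * G w)%:E = c%:E * \int[P]_w (f (X w))%:E)%E.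
Proof.
move=> mG G0 c0 GA mf f0.
have mX : measurable_fun setT X by exact: measurable_funP.
have mEf : measurable_fun [set: R] (EFin \o f) by exact/measurable_EFinP.
pose h := nnsfun_approx measurableT mEf.
have mh n : measurable_fun setT (h n) by exact: measurable_funP.
have hf x : (h n x)%:E @[n --> \oo] --> (f x)%:E.
  by apply: (cvg_nnsfun_approx measurableT mEf) => // y _; rewrite lee_fin.
have h_nd x : {homo h ^~ x : m n / (m <= n)%N >-> m <= n}.
  by move=> m n mn; exact/lefP/nd_nnsfun_approx.
have simple_case n :
    (\int[P]_w (h n (X w) * G w)%:E = c%:E * \int[P]_w (h n (X w))%:E)%E.
  have hE x : h n x = \sum_(y \in range (h n)) y * \1_(h n @^-1` [set y]) x.
    by rewrite -fimfunE.
  have mI y : measurable (h n @^-1` [set y]) by [].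
  have mIX y : measurable_fun setT
      (fun w => y * \1_(h n @^-1` [set y]) (X w)).
    by apply: measurable_funM => //; apply: measurableT_comp.
  have y0 y w : 0 <= y * \1_(h n @^-1` [set y]) (X w).
    by have := nnfun_muleindic_ge0 (h n) y (X w); rewrite lee_fin.
  transitivity (\int[P]_w (\sum_(y \in range (h n))
     (y * \1_(h n @^-1` [set y]) (X w) * G w)%:E))%E.
    apply: eq_integral => w _; rewrite hE fsumEFin // !fsbig_finite //=.
    by rewrite mulr_suml.
  rewrite ge0_integral_fsum //; last 2 first.
  - by move=> y; apply/measurable_EFinP/measurable_funM.
  - by move=> y w _; rewrite lee_fin mulr_ge0.
  transitivity (c%:E * \int[P]_w (\sum_(y \in range (h n))
     (y * \1_(h n @^-1` [set y]) (X w))%:E))%E; last first.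
    by congr (_ * _)%E; apply: eq_integral => w _; rewrite hE fsumEFin.
  rewrite ge0_integral_fsum //; last 2 first.
  - by move=> y; apply/measurable_EFinP.
  - by move=> y w _; rewrite lee_fin.
  rewrite !fsbig_finite //= ge0_sume_distrr; last first.
    by move=> y _; apply: integral_ge0 => w _; rewrite lee_fin.
  apply: eq_big_seq => y; rewrite in_fset_set // inE => -[x _ hx].
  have yge0 : 0 <= y by rewrite -hx.
  have mi : measurable_fun setT (fun w => \1_(h n @^-1` [set y]) (X w) : R).
    by apply: measurableT_comp.
  under eq_integral do rewrite -mulrA EFinM.
  rewrite ge0_integralZl ?lee_fin //; last 2 first.
  - by apply/measurable_EFinP/measurable_funM.
  - by move=> w _; rewrite lee_fin mulr_ge0.
  under [in RHS]eq_integral do rewrite EFinM.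
  rewrite ge0_integralZl ?lee_fin //; last by apply/measurable_EFinP.
  by rewrite GA // muleCA.
have lhs : (\int[P]_w (h n (X w) * G w)%:E)%E @[n --> \oo]
    --> (\int[P]_w (f (X w) * G w)%:E)%E.
  have -> : (\int[P]_w (f (X w) * G w)%:E =
      \int[P]_w limn (fun n => (h n (X w) * G w)%:E))%E.
    apply: eq_integral => w _; apply/esym/cvg_lim => //.
    under eq_fun do rewrite EFinM.
    by rewrite EFinM; apply: cvgeZr.
  apply: cvg_monotone_convergence => //.
  - by move=> n; apply/measurable_EFinP/measurable_funM => //; apply: measurableT_comp.
  - by move=> n w _; rewrite lee_fin mulr_ge0.
  - by move=> w _ m n mn; rewrite lee_fin ler_wpM2r// h_nd.
have rhs : (\int[P]_w (h n (X w))%:E)%E @[n --> \oo]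
    --> (\int[P]_w (f (X w))%:E)%E.
  have -> : (\int[P]_w (f (X w))%:E =
      \int[P]_w limn (fun n => (h n (X w))%:E))%E.
    by apply: eq_integral => w _; apply/esym/cvg_lim.
  apply: cvg_monotone_convergence => //.
  - by move=> n; apply/measurable_EFinP; apply: measurableT_comp.
  - by move=> n w _; rewrite lee_fin.
  - by move=> w _ m n mn; rewrite lee_fin h_nd.
have E : (fun n => \int[P]_w (h n (X w) * G w)%:E)%E =
    (fun n => c%:E * \int[P]_w (h n (X w))%:E)%E by apply/funext.
rewrite E in lhs; apply: (cvg_unique _ lhs) => //.
exact: cvgeZl.
Qed.

(** Independence is the case where every [g n] is an indicator. The indicators
    are replaced by general functions one index at a time: [H k] is the
    statement in which only [g 0], ..., [g k.-1] are arbitrary, and the product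
    of the other factors is the weight of [ge0_integral_mul_comp]. Finiteness of
    the expectations makes the constant of that lemma a real number. *)
Lemma independent_expectation_prod (X : nat -> {RV P >-> R}) (N : nat)
    (g : nat -> R -> R) :
  mutually_independent X ->
  (forall n, measurable_fun [set: R] (g n)) -> (forall n x, 0 <= g n x) ->
  (forall n, \int[P]_w (g n (X n w))%:E < +oo)%E ->
  (\int[P]_w (\prod_(0 <= n < N) g n (X n w))%:E =
     \prod_(0 <= n < N) \int[P]_w (g n (X n w))%:E)%E.
Proof.
move=> indX.
suff H k : forall g : nat -> R -> R,
  (forall n, measurable_fun [set: R] (g n)) -> (forall n x, 0 <= g n x) ->
  (forall n, \int[P]_w (g n (X n w))%:E < +oo)%E ->
  (forall n, (k <= n < N)%N -> exists2 A, measurable A & g n = \1_A) ->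
  (\int[P]_w (\prod_(0 <= n < N) g n (X n w))%:E =
     \prod_(0 <= n < N) \int[P]_w (g n (X n w))%:E)%E.
  move=> mg g0 goo; apply: (H N) => // n /andP[Nn nN].
  by move: (leq_trans nN Nn); rewrite ltnn.
have mX n : measurable_fun setT (X n) by exact: measurable_funP.
elim: k => [|k IH] {}g mg g0 goo gI.
  have {}gI n : exists A, measurable A /\ ((n < N)%N -> g n = \1_A).
    case: (ltnP n N) => nN; last by exists setT.
    by have [A mA gA] := gI n nN; exists A.
  have [A /all_and2[mA gA]] := choice gI.
  pose J := [fset n in index_iota 0 N]%fset.
  have bigJ (f : nat -> \bar R) :
      (\prod_(0 <= n < N) f n = \prod_(n <- J) f n)%E.
    by apply: perm_big; apply: uniq_perm; rewrite ?iota_uniq ?fset_uniq // => n; rewrite !inE.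
  have inJ n : (n \in J) = (n < N)%N by rewrite !inE mem_index_iota.
  have mXA n : measurable (X n @^-1` A n).
    by rewrite -[_ @^-1` _]setTI; exact: mX.
  have indJ : (\int[P]_w (\1_(\bigcap_(j in [set` J]) X j @^-1` A j) w)%:E =
      \prod_(j <- J) P (X j @^-1` A j))%E.
    rewrite integral_indic // ?setIT; last exact: bigcap_measurableType.
    exact: indX.
  transitivity (\int[P]_w (\1_(\bigcap_(j in [set` J]) X j @^-1` A j) w)%:E)%E.
    apply: eq_integral => w _; congr EFin; rewrite indicE.
    have [wJ|] := boolP (w \in _).
      rewrite big_seq big1 // => n; rewrite mem_index_iota /= => nN.
      rewrite (gA _ nN) indicE mem_set //.
      by move: wJ; rewrite inE => /(_ n) /=; rewrite inJ; exact.
    move=> wJ; apply/eqP; rewrite prodf_seq_eq0; apply/hasP.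
    move: wJ; rewrite notin_setE => /existsNP[n /not_implyP[/= nJ nA]].
    exists n; first by move: nJ; rewrite inJ mem_index_iota.
    rewrite gA -?inJ // indicE memNset //.
  rewrite indJ bigJ; apply: eq_big_seq => n; rewrite inJ => nN.
  by rewrite -[X in P X]setIT -integral_indic // gA.
have [Nk|kN] := leqP N k.
  apply: IH => // n /andP[kn nN].
  by have := leq_trans nN (leq_trans Nk kn); rewrite ltnn.
have kin : k \in index_iota 0 N by rewrite mem_index_iota.
have kuniq : uniq (index_iota 0 N) by rewrite iota_uniq.
have mgX n : measurable_fun setT (fun w => g n (X n w)).
  by apply: measurableT_comp.
pose G w := \prod_(0 <= n < N | n != k) g n (X n w).
pose m n := fine (\int[P]_w (g n (X n w))%:E)%E.
have mE n : (m n)%:E = (\int[P]_w (g n (X n w))%:E)%E.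
  rewrite fineK // ge0_fin_numE //.
  by apply: integral_ge0 => w _; rewrite lee_fin.
pose c := \prod_(0 <= n < N | n != k) m n.
have prodE (f : nat -> R) (p : pred nat) :
    ((\prod_(0 <= n < N | p n) f n)%:E = \prod_(0 <= n < N | p n) (f n)%:E)%E.
  exact: (big_morph EFin (@EFinM R)).
have cE : (c%:E = \prod_(0 <= n < N | n != k) \int[P]_w (g n (X n w))%:E)%E.
  by rewrite prodE; apply: eq_bigr.
rewrite (bigD1_seq k) //= -cE muleC.
under eq_integral do rewrite (bigD1_seq k) //= -/(G _).
apply: (ge0_integral_mul_comp (f := g k)) => //.
- rewrite /G; under eq_fun do rewrite -big_filter.
  exact: measurable_prod.
- by move=> w; apply: prodr_ge0.
- by apply: prodr_ge0 => n _; rewrite -lee_fin mE integral_ge0 // => w _; rewrite lee_fin.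
(* Testing against the event [A] means putting its indicator at index [k]. *)
move=> A mA.
pose g' n := if n == k then \1_A else g n.
have g'k n : n != k -> g' n = g n by rewrite /g' => /negbTE ->.
have g'E : g' k = \1_A by rewrite /g' eqxx.
have := IH g' _ _ _ _.
rewrite (bigD1_seq k) //= g'E muleC.
under eq_integral do rewrite (bigD1_seq k) //= g'E.
rewrite cE => IHg'.
transitivity (\int[P]_x (\1_A (X k x) * \prod_(0 <= i < N | i != k) g' i (X i x))%:E)%E.
  apply: eq_integral => w _; congr (_ * _)%:E; apply: eq_bigr => n nk.
  by rewrite g'k.
rewrite IHg'.
- congr (_ * _)%E; apply: eq_bigr => n nk.
  by rewrite g'k.
- by move=> n; rewrite /g'; case: ifP.
- by move=> n x; rewrite /g'; case: ifP.
- move=> n; rewrite /g'; case: eqP => // _.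
  rewrite (integral_indic P measurableT (A := X n @^-1` A)) ?setIT; last first.
    by rewrite -[_ @^-1` _]setTI; exact: mX.
  by rewrite (le_lt_trans (probability_le1 _ _)) ?ltry // -[_ @^-1` _]setTI; exact: mX.
- move=> n /andP[kn nN]; have [->|nk] := eqVneq n k; first by exists A.
  by rewrite g'k //; apply: gI; rewrite nN andbT ltn_neqAle eq_sym nk.
Qed.
End independence.

(** * Subgaussian tails of weighted sums *)

Section tails.
Context d (T : measurableType d) (R : realType) (P : probability T R).

(** Chernoff's bound at the parameter [t], which minimizes
    [exp (l^2 N / 2 - l t N)] over [l]. *)
Lemma weighted_sum_tail (xi : nat -> {RV P >-> R}) (c : nat -> R) (N : nat) (t : R) :
  subnormal_sequence xi -> (forall n, `|c n| <= 1) -> 0 < t ->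
  (P [set w | (t * N%:R <= \sum_(0 <= n < N) c n * xi n w)%R] <=
     (expR (- (t ^+ 2 / 2 * N%:R)))%:E)%E.
Proof.
move=> [indxi subxi] c1 t0.
pose Y w := \sum_(0 <= n < N) c n * xi n w.
have mxi n : measurable_fun setT (xi n) by exact: measurable_funP.
have mY : measurable_fun setT Y.
  by apply: measurable_sum => n; exact: measurable_funM.
pose X : {RV P >-> R} := HB.pack Y (isMeasurableFun.Build _ _ _ _ _ mY).
apply: (le_trans (chernoff X (t * N%:R) t0)).
have mgfE (Z : T -> R) l : ('M_P Z l = \int[P]_w (expR (l * Z w))%:E)%E.
  by rewrite /mmt_gen_fun unlock; apply: eq_integral => w _ /=; rewrite mulrC.
have boundE n : (\int[P]_w (expR (t * c n * xi n w))%:E <= (expR (t ^+ 2 / 2))%:E)%E.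
  rewrite -mgfE; apply: (le_trans (subxi n _)).
  rewrite lee_fin ler_expR ler_pM2r // exprMn ler_piMr ?sqr_ge0 //.
  by rewrite -real_normK ?num_real // expr_le1.
have MX : ('M_P X t <= (expR (t ^+ 2 / 2 * N%:R))%:E)%E.
  rewrite mgfE.
  under eq_integral => w _.
    rewrite /X /= /Y mulr_sumr expR_sum.
    under eq_bigr do rewrite mulrA.
    over.
  rewrite (independent_expectation_prod N (g := fun n x => expR (t * c n * x)) indxi).
  - have -> : expR (t ^+ 2 / 2 * N%:R) = \prod_(0 <= n < N) expR (t ^+ 2 / 2).
      by rewrite prodr_const_nat subn0 expRM_natr.
    rewrite (big_morph EFin (@EFinM R) (erefl _)).
    pose le0 (x y : \bar R) := (0 <= x <= y)%E.
    suff /andP[] : le0 (\prod_(0 <= n < N) \int[P]_w (expR (t * c n * xi n w))%:E)%E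
        (\prod_(0 <= n < N) (expR (t ^+ 2 / 2))%:E)%E by [].
    apply: (big_ind2 le0) => [|x1 x2 y1 y2 /andP[? ?] /andP[? ?]|n _].
    + by rewrite /le0 lee_fin ler01 lexx.
    + by rewrite /le0 mule_ge0 //= lee_pmul.
    + by rewrite /le0 boundE integral_ge0 // => w _; rewrite lee_fin expR_ge0.
  - move=> n; apply: measurableT_comp => //; exact: measurable_funM.
  - by move=> n x; exact: expR_ge0.
  - by move=> n; rewrite (le_lt_trans (boundE n)) ?ltry.
apply: (le_trans (lee_wpmul2r _ MX)); first by rewrite lee_fin expR_ge0.
rewrite -EFinM -expRD lee_fin ler_expR; lra.
Qed.

Lemma weighted_sum_tail_norm (xi : nat -> {RV P >-> R}) (c : nat -> R) (N : nat) (t : R) :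
  subnormal_sequence xi -> (forall n, `|c n| <= 1) -> 0 < t ->
  (P [set w | (t * N%:R <= `|\sum_(0 <= n < N) c n * xi n w|)%R] <=
     (2 * expR (- (t ^+ 2 / 2 * N%:R)))%:E)%E.
Proof.
move=> subxi c1 t0.
have mxi n : measurable_fun setT (xi n) by exact: measurable_funP.
have mS (b : nat -> R) :
    measurable [set w | t * N%:R <= \sum_(0 <= n < N) b n * xi n w].
  rewrite -[X in measurable X]setTI; apply: measurable_fun_le => //.
  by apply: measurable_sum => n; exact: measurable_funM.
have -> : [set w | t * N%:R <= `|\sum_(0 <= n < N) c n * xi n w|] =
    [set w | t * N%:R <= \sum_(0 <= n < N) c n * xi n w] `|`
    [set w | t * N%:R <= \sum_(0 <= n < N) - c n * xi n w].
  apply/seteqP; split=> w /=; under [X in _ \/ _ <= X]eq_bigr do rewrite mulNr.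
  - by rewrite sumrN ler_normr => /orP[]; [left|right].
  - by rewrite sumrN ler_normr => -[] ->; rewrite ?orbT.
rewrite mulrDl mul1r EFinD (le_trans (measureU2 _ _ _)) // leeD //.
- exact: weighted_sum_tail.
- by apply: weighted_sum_tail => // n; rewrite normrN.
Qed.

End tails.

Section summability.
Context (R : realType).

(** Half of the exponential decay absorbs the polynomial factor; the other half
    leaves a geometric series. *)
Lemma nneseries_poly_expR (C D : nat) (a : R) : 0 < a ->
  (\sum_(0 <= N <oo) ((C * N.+1 ^ D)%:R * expR (- (a * N%:R)))%:E < +oo)%E.
Proof.
move=> a0; pose b := a / 2; have b0 : 0 < b by rewrite divr_gt0.
pose L := D.+1`!%:R * expR b / b ^+ D.+1.
have L0 : 0 <= L by rewrite divr_ge0 ?mulr_ge0 ?expR_ge0 // exprn_ge0 // ltW.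
pose K := C%:R * L.
have K0 : 0 <= K by rewrite mulr_ge0.
pose z := expR (- b).
have z0 : 0 < z by exact: expR_gt0.
have z1 : z < 1 by rewrite expR_lt1 oppr_lt0.
(* From the Taylor bound [1 + x^(D+1) / (D+1)! <= exp x] at [x = b (N + 1)]. *)
have polyL N : (N.+1 ^ D)%:R * expR (- b * N%:R) <= L.
  have N0 : 0 <= b * N.+1%:R by rewrite mulr_ge0 // ltW.
  rewrite mulNr expRN ler_pdivrMr ?expR_gt0 // /L mulrAC ler_pdivlMr ?exprn_gt0 //.
  have -> : D.+1`!%:R * expR b * expR (b * N%:R) = D.+1`!%:R * expR (b * N.+1%:R).
    by rewrite -mulrA -expRD -natr1 mulrDr mulr1 [b + _]addrC.
  have := expR_ge1Dxn D N0; set e := expR _ => eD.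
  have : (b * N.+1%:R) ^+ D.+1 / D.+1`!%:R <= e by lra.
  rewrite ler_pdivrMr ?ltr0n ?fact_gt0 // [e * _]mulrC; apply: le_trans.
  rewrite [leRHS]exprMn mulrC ler_wpM2l ?(exprn_ge0 _ (ltW b0)) // -natrX ler_nat.
  by rewrite leq_pexp2l.
have bound N : (C * N.+1 ^ D)%:R * expR (- (a * N%:R)) <= geometric K z N.
  rewrite /geometric /= /z -expRM_natr.
  have -> : - (a * N%:R) = - b * N%:R + - b * N%:R by rewrite /b; lra.
  by rewrite expRD mulrA ler_wpM2r ?expR_ge0 // natrM /K -mulrA ler_wpM2l.
apply: (@le_lt_trans _ _ (K / (1 - z))%:E); last exact: ltry.
apply: lime_le.
  by apply: is_cvg_nneseries => N _ _; rewrite lee_fin mulr_ge0 // expR_ge0.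
apply: nearW => n; rewrite sumEFin lee_fin.
apply: le_trans (geometric_le_lim n K0 z0 _); last by rewrite gtr0_norm.
by apply: ler_sum => i _; exact: bound.
Qed.
End summability.

(** * A uniform law for polynomially many weights *)

Section uniform_law.
Context d (T : measurableType d) (R : realType) (P : probability T R).

(** Polynomial growth of the families is what makes the probabilities of the
    bad events, bounded by the union bound, summable. The event is defined for
    one [t] at a time; letting [t] run through the numbers [1 / (k + 1)] keeps the
    exceptional set null. *)
Lemma ae_weighted_averages_small (xi : nat -> {RV P >-> R}) (I : nat -> finType)
    (c : forall N, I N -> nat -> R) (C D : nat) :
  subnormal_sequence xi -> (forall N i n, `|c N i n| <= 1) ->
  (forall N, #|I N| <= C * N.+1 ^ D)%N ->
  {ae P, forall w, forall t, 0 < t -> \forall N \near \oo, forall i : I N,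
     `|\sum_(0 <= n < N) c N i n * xi n w| <= t * N%:R}.
Proof.
move=> subxi c1 IC.
have mxi n : measurable_fun setT (xi n) by exact: measurable_funP.
pose B (t : R) N (i : I N) :=
  [set w | t * N%:R <= `|\sum_(0 <= n < N) c N i n * xi n w|].
have mB t N i : measurable (B t N i).
  rewrite -[X in measurable X]setTI; apply: measurable_fun_le => //.
  apply: measurableT_comp => //.
  by apply: measurable_sum => n; exact: measurable_funM.
pose F t N := \bigcup_(i in [set: I N]) B t N i.
have mF t N : measurable (F t N) by apply: fin_bigcup_measurable.
have PF t N : 0 < t -> (P (F t N) <=
    ((2 * C * N.+1 ^ D)%:R * expR (- (t ^+ 2 / 2 * N%:R)))%:E)%E.
  move=> t0.
  apply: (@le_trans _ _ (\sum_(i : I N) P (B t N i))%E).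
    rewrite fsbig_seq ?index_enum_uniq //; apply: content_sub_fsum => //.
    by move=> w [i _ Bw]; exists i => //=; rewrite mem_index_enum.
  apply: (@le_trans _ _ (\sum_(i : I N) (2 * expR (- (t ^+ 2 / 2 * N%:R)))%:E)%E).
    by apply: lee_sum => i _; exact: weighted_sum_tail_norm.
  rewrite sumEFin sumr_const lee_fin -[leLHS]mulr_natl mulrA ler_wpM2r ?expR_ge0 //.
  by rewrite mulrC -natrM ler_nat -mulnA leq_mul2l IC orbT.
have null t : 0 < t -> P (lim_sup_set (F t)) = 0%E.
  move=> t0; apply: lim_sup_set_cvg0 => //.
  apply: (le_lt_trans _ (nneseries_poly_expR (2 * C) D (_ : 0 < t ^+ 2 / 2))).
    by apply: lee_nneseries => // N _; exact: PF.
  by rewrite divr_gt0 // exprn_gt0.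
have : {ae P, forall w, forall k : nat, ~ lim_sup_set (F k.+1%:R^-1) w}.
  apply: ae_foralln => k; exists (lim_sup_set (F k.+1%:R^-1)); split.
  - by apply: bigcap_measurableType => N _; apply: bigcup_measurable.
  - by apply: null; rewrite invr_gt0.
  - by move=> w /contrapT.
apply: filterS => w notF t t0.
have [k kt] : exists k : nat, k.+1%:R^-1 <= t.
  exists (Num.truncn t^-1); rewrite invf_ple ?posrE //.
  by rewrite ltW // truncnS_gt.
have /existsNP[N0 /not_implyP[_ N0F]] := notF k.
exists N0 => // N /= N0N i.
have : ~ B k.+1%:R^-1 N i w by move=> Bw; apply: N0F; exists N => //; exists i.
rewrite /B /= => /negP; rewrite -ltNge => /ltW /le_trans; apply.
by rewrite ler_wpM2r.
Qed.

(** The value at index [N - 1] is the weighted sum over [n < N] for the unit mass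
    at [N - 1], so the uniform law with [t = 1] bounds it by [N] for large [N]; the
    constant [K] takes care of the finitely many other indices. *)
Lemma subnormal_linear_growth (xi : nat -> {RV P >-> R}) :
  subnormal_sequence xi ->
  {ae P, forall w, exists K, forall n, `|xi n w| <= K * n.+1%:R}.
Proof.
move=> subxi.
pose delta N (_ : unit) (n : nat) : R := (n == N.-1)%:R.
have delta1 N i n : `|delta N i n| <= 1.
  by rewrite /delta; case: eqP => _; rewrite ?normr1 ?normr0.
have card1 N : (#|{: unit}| <= 1 * N.+1 ^ 0)%N by rewrite card_unit.
have := ae_weighted_averages_small (I := fun=> unit) (c := delta) subxi delta1 card1.
apply: filterS => w /(_ 1 ltr01)[N0 _ small].
exists (1 + \sum_(0 <= n < N0) `|xi n w|) => n.
have S0 : 0 <= \sum_(0 <= n < N0) `|xi n w| by apply: sumr_ge0.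
have [nN|Nn] := ltnP n N0.
  rewrite -[leLHS]mulr1 ler_pM ?ler1n //.
  rewrite (bigD1_seq n) ?mem_index_iota ?iota_uniq //= addrCA lerDl.
  by rewrite addr_ge0 // sumr_ge0.
have := small n.+1 (leqW Nn) tt.
rewrite big_nat_recr //= /delta eqxx mul1r mul1r big1_seq ?add0r => [H|m].
  by rewrite mulrDl mul1r (le_trans H) // lerDl mulr_ge0.
by rewrite mem_index_iota => /andP[_ mn]; rewrite ltn_eqF // mul0r.
Qed.

End uniform_law.

(** * Approximation of polynomials by a finite grid *)

Section grid.
Context (R : realType).

Lemma lipschitz_of_bounded_derive (f df : R -> R) :
  (forall x : R, is_derive x 1 f (df x)) -> (forall x, `|df x| <= 1) ->
  forall x y, `|f x - f y| <= `|x - y|.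
Proof.
move=> fdf df1 x y; wlog yx : x y / y <= x.
  by move=> H; case: (leP y x) => [/H //|/ltW /H]; rewrite distrC [leRHS]distrC.
have [|c _ ->] := @MVT_segment R f df y x yx.
- apply: continuous_subspaceT => z.
  by apply: differentiable_continuous; apply/derivable1_diffP.
by rewrite normrM ler_piMl.
Qed.

Lemma cos_lipschitz (x y : R) : `|cos x - cos y| <= `|x - y|.
Proof.
apply: (lipschitz_of_bounded_derive (df := fun z => - sin z)) => z.
by rewrite normrN sin_max.
Qed.

Lemma sin_lipschitz (x y : R) : `|sin x - sin y| <= `|x - y|.
Proof. by apply: (lipschitz_of_bounded_derive (df := cos)) => z; rewrite cos_max. Qed.

(** Of the exponent [D + 2], [D] compensates the size of the monomials on [0, N),
    one unit the number of terms and one unit the linear growth of the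
    coefficients [x n]. *)
Definition mesh (D N : nat) : nat := N.+1 ^ D.+2.

(** An index [j] encodes the coefficient [j / mesh D N - N], which ranges over
    [-N, N]: as [N] grows, every given real polynomial is eventually covered. *)
Definition grid (D N : nat) : finType :=
  {ffun 'I_D -> 'I_(2 * N * mesh D N).+1}.

Definition grid_eval (D N : nat) (i : grid D N) (x : R) : R :=
  \sum_(k < D) ((i k)%:R / (mesh D N)%:R - N%:R) * x ^+ k.

Lemma card_grid (D N : nat) :
  (#|grid D N| <= 2 ^ D * N.+1 ^ (D.+3 * D))%N.
Proof.
rewrite card_ffun !card_ord expnM -expnMn.
have H : ((2 * N * mesh D N).+1 <= 2 * N.+1 ^ D.+3)%N.
  have : (0 < mesh D N)%N by rewrite expn_gt0.
  rewrite [(N.+1 ^ D.+3)%N]expnS -/(mesh D N); nia.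
have [->|D0] := posnP D; first by rewrite !expn0.
by rewrite leq_exp2r.
Qed.

Lemma round_to_mesh (N M : nat) (a : R) : (0 < M)%N -> `|a| <= N%:R ->
  exists j : 'I_(2 * N * M).+1, `|a - (j%:R / M%:R - N%:R)| <= M%:R^-1.
Proof.
move=> M0 aN; have M0' : 0 < M%:R :> R by rewrite ltr0n.
pose s := (a + N%:R) * M%:R.
have s0 : 0 <= s by rewrite mulr_ge0 //; move: aN; rewrite ler_norml; lra.
have /andP[js sj] := truncn_itv s0.
have jb : (Num.truncn s < (2 * N * M).+1)%N.
  rewrite ltnS -(ler_nat R) (le_trans js) // !natrM ler_pM2r //.
  by move: aN; rewrite ler_norml; lra.
exists (Ordinal jb) => /=.
have -> : a - ((Num.truncn s)%:R / M%:R - N%:R) = (s - (Num.truncn s)%:R) / M%:R.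
  by rewrite /s; field; rewrite gt_eqF.
rewrite normrM [X in _ * X]gtr0_norm ?invr_gt0 // ler_piMl ?invr_ge0 ?ltW //.
rewrite ger0_norm ?subr_ge0 // -natr1 in sj *; lra.
Qed.

Lemma grid_approx (D N : nat) (p : {poly R}) : (size p <= D)%N ->
  (forall k, `|p`_k| <= N%:R) ->
  exists i : grid D N, forall n, (n < N)%N ->
    `|p.[n%:R] - grid_eval i n%:R| <= D%:R * N%:R ^+ D / (mesh D N)%:R.
Proof.
move=> pD pN; have M0 : (0 < mesh D N)%N by rewrite expn_gt0.
have [i iP] := choice (fun k : 'I_D => round_to_mesh M0 (pN k)).
exists [ffun k => i k] => n nN.
rewrite (horner_coef_wide _ pD) -sumrB.
apply: (le_trans (ler_norm_sum _ _ _)).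
apply: (@le_trans _ _ (\sum_(k < D) N%:R ^+ D / (mesh D N)%:R)); last first.
  by rewrite sumr_const card_ord -[leLHS]mulr_natl mulrA.
apply: ler_sum => k _; rewrite ffunE -mulrBl normrM mulrC ler_pM //.
rewrite ger0_norm ?exprn_ge0 // (@le_trans _ _ (N%:R ^+ k)) //.
  by rewrite lerXn2r ?nnegrE // ler_nat ltnW.
by rewrite ler_weXn2l ?ler1n 1?(leq_ltn_trans _ nN) // ltnW.
Qed.

(** For large [N] the grid contains a point within [O(N^D / mesh D N)] of [p] on
    [0, N), and the resulting error in the sum is bounded uniformly in [N], hence
    below [t / 2 * N]. *)
Lemma small_on_grid_small (phi : R -> R) (D : nat) (x : nat -> R) (K : R) :
  (forall a b, `|phi a - phi b| <= `|a - b|) ->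
  (forall n, `|x n| <= K * n.+1%:R) ->
  (forall t, 0 < t -> \forall N \near \oo, forall i : grid D N,
     `|\sum_(0 <= n < N) phi (2 * pi * grid_eval i n%:R) * x n| <= t * N%:R) ->
  forall p : {poly R}, (size p <= D)%N -> forall t, 0 < t ->
    \forall N \near \oo,
     `|\sum_(0 <= n < N) phi (2 * pi * p.[n%:R]) * x n| <= t * N%:R.
Proof.
move=> phiL xK gridS p pD t t0.
have pi0 : 0 <= 2 * pi :> R by rewrite mulr_ge0 // pi_ge0.
have K0 : 0 <= K by rewrite -[K]mulr1 (le_trans _ (xK 0%N)).
pose A := \sum_(k < D) `|p`_k|.
have pA k : `|p`_k| <= A.
  have [kD|Dk] := ltnP k D.
    rewrite /A (bigD1 (Ordinal kD)) //= lerDl; exact: sumr_ge0.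
  by rewrite nth_default ?(leq_trans pD) // normr0; apply: sumr_ge0.
near=> N.
have NA : A <= N%:R by near: N; exact: nbhs_infty_ger.
have NK : K * (2 * pi * D%:R) <= t / 2 * N%:R.
  rewrite -ler_pdivrMl ?divr_gt0 //; near: N; exact: nbhs_infty_ger.
have [i iP] := grid_approx pD (fun k => le_trans (pA k) NA).
have gridi : `|\sum_(0 <= n < N) phi (2 * pi * grid_eval i n%:R) * x n| <= t / 2 * N%:R.
  by move: i {iP}; near: N; apply: gridS; rewrite divr_gt0.
set S := \sum_(0 <= n < N) _; set S' := \sum_(0 <= n < N) _ in gridi.
suff : `|S - S'| <= K * (2 * pi * D%:R).
  have := ler_normD (S - S') S'; rewrite subrK; lra.
rewrite /S /S' -sumrB (le_trans (ler_norm_sum _ _ _)) //.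
apply: (@le_trans _ _ (\sum_(0 <= n < N)
   (2 * pi * (D%:R * N%:R ^+ D / (mesh D N)%:R)) * (K * N%:R))).
  rewrite big_nat [leRHS]big_nat; apply: ler_sum => n /andP[_ nN].
  rewrite -mulrBl normrM ler_pM //.
    apply: (le_trans (phiL _ _)); rewrite -mulrBr normrM ger0_norm //.
    by rewrite ler_wpM2l // iP.
  by rewrite (le_trans (xK n)) // ler_wpM2l // ler_nat.
rewrite sumr_const_nat subn0 -[leLHS]mulr_natl.
(* The powers of [N] cancel against the mesh, leaving a bound free of [N]. *)
have -> : N%:R * (2 * pi * (D%:R * N%:R ^+ D / (mesh D N)%:R) * (K * N%:R)) =
   (K * (2 * pi * D%:R)) * (N%:R ^+ D.+2 / (mesh D N)%:R) :> R.
  by rewrite !exprS; ring.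
rewrite ler_piMr //; first exact: mulr_ge0 K0 (mulr_ge0 pi0 (ler0n _ _)).
rewrite ler_pdivrMr ?ltr0n ?expn_gt0 //.
by rewrite mul1r /mesh natrX lerXn2r ?nnegrE // ler_nat.
Unshelve. all: by end_near.
Qed.
End grid.

(** * Oscillation *)

Section conclusion.
Context (R : realType).

Lemma cexpi_average_cvg0 (x theta : nat -> R) :
  (forall t, 0 < t -> \forall N \near \oo,
     `|\sum_(0 <= n < N) cos (theta n) * x n| <= t * N%:R) ->
  (forall t, 0 < t -> \forall N \near \oo,
     `|\sum_(0 <= n < N) sin (theta n) * x n| <= t * N%:R) ->
  (fun N : nat => N%:R^-1 *
     \sum_(0 <= n < N) real_complex R (x n) * cexpi (theta n) : R[i]^o)
    @ \oo --> (0 : R[i]^o).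
Proof.
move=> hcos hsin; apply/cvgr0Pnorm_le => -[er ei] /=.
rewrite ltcE /= => /andP[/eqP -> er0].
have er2 : 0 < er / 2 by rewrite divr_gt0.
near=> N.
have Ncos : `|\sum_(0 <= n < N) cos (theta n) * x n| <= er / 2 * N%:R.
  by near: N; exact: hcos.
have Nsin : `|\sum_(0 <= n < N) sin (theta n) * x n| <= er / 2 * N%:R.
  by near: N; exact: hsin.
have N0 : (0 < N)%N by near: N; exact: nbhs_infty_gt.
have sumC : \sum_(0 <= n < N) real_complex R (x n) * cexpi (theta n) =
    ((\sum_(0 <= n < N) cos (theta n) * x n) +i*
     (\sum_(0 <= n < N) sin (theta n) * x n))%C.
  elim: (N) => [|m IH]; first by rewrite !big_nil.
  rewrite !big_nat_recr //= IH; apply/eqP; rewrite eq_complex /=.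
  by rewrite !mul0r subr0 addr0 ![x m * _]mulrC !eqxx.
rewrite sumC; set A := \sum_(0 <= n < N) _ in Ncos *; set B := \sum_(0 <= n < N) _ in Nsin *.
rewrite normrM normfV normr_nat ler_pdivrMl ?ltr0n // normc_def /=.
have -> : N%:R * (er +i* 0)%C = (N%:R * er)%:C%C by rewrite rmorphM rmorph_nat.
rewrite lecR (@le_trans _ _ (`|A| + `|B|)) //; last lra.
rewrite -[leRHS]ger0_norm ?addr_ge0 // -sqrtr_sqr ler_sqrt ?sqr_ge0 //.
rewrite -[A ^+ 2]real_normK ?num_real // -[B ^+ 2]real_normK ?num_real //.
have : 0 <= `|A| * `|B| by rewrite mulr_ge0.
rewrite sqrrD; lra.
Unshelve. all: by end_near.
Qed.
End conclusion.

Theorem theorem2 (R : realType) (d : measure_display) (T : measurableType d)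
    (P : probability T R) (xi : nat -> {RV P >-> R}) :
  subnormal_sequence xi ->
  {ae P, forall w : T, fully_oscillating (fun n : nat => real_complex R (xi n w))}.
Proof.
move=> subxi.
have gridae (phi : R -> R) D : (forall a, `|phi a| <= 1) ->
  {ae P, forall w t, 0 < t -> \forall N \near \oo, forall i : grid D N,
    `|\sum_(0 <= n < N) phi (2 * pi * grid_eval i n%:R) * xi n w| <= t * N%:R}.
  move=> phi1; apply: (ae_weighted_averages_small
    (c := fun N i n => phi (2 * pi * grid_eval i n%:R)) subxi) => //.
  exact: card_grid.
have : {ae P, forall w (e : nat), oscillating e (fun n => real_complex R (xi n w))}.
  apply: ae_foralln => e.
  have := subnormal_linear_growth subxi.
  have := gridae sin e.+1 (@sin_max R); have := gridae cos e.+1 (@cos_max R).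
  apply: filterS3 => w wcos wsin [K wK] p pe.
  apply: (cexpi_average_cvg0 (theta := fun n => 2 * pi * p.[n%:R])).
  - exact: (small_on_grid_small (@cos_lipschitz R) wK wcos pe).
  - exact: (small_on_grid_small (@sin_lipschitz R) wK wsin pe).
by apply: filterS => w osc e _; exact: osc.
Qed.
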